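(* Let $p,q$ be distinct primes, $n,m$ positive integers, $G=\mathrm{El}(p^n)\times\mathrm{El}(q^m)$, $\alpha=\frac{p^n-1}{p-1}$, $\beta=\frac{q^m-1}{q-1}$. Let \[ T_1=\begin{bmatrix} 0& p^n-1 & (p^n-1)(q^m-1) & q^m-1\\ 1& p-2 & (p-1)(q^m-1) & 0\\ 1& p-1 & (p-1)(q-1)-1 & q-1\\ 1& 0 & (p^n-1)(q-1) & q-2 \end{bmatrix}. \] Then the characteristic polynomial of the adjacency matrix of the power graph $\mathcal{P}(G)$ is \[ \phi_A(\mathcal{P}(G),x)=\phi(T_1,x)\,(x+1)^{p^nq^m-(\alpha+1)(\beta+1)}\,(x-pq+p+q)^{(\alpha-1)(\beta-1)} f(x)^{\alpha-1}g(x)^{\beta-1}, \] where $f(x)$ and $g(x)$ are the characteristic polynomials of $\begin{bmatrix} p-2 & (p-1)(q^m-1)\\ p-1 & (p-1)(q-1)-1\end{bmatrix}$ and $\begin{bmatrix}(p-1)(q-1)-1 & q-1\\ (p^n-1)(q-1) & q-2\end{bmatrix}$, respectively.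
   Context: $\mathrm{El}(p^n)$ denotes the elementary abelian group of order $p^n$. For a group $G$, the power graph $\mathcal{P}(G)$ is the simple graph with vertex set $G$ in which distinct $a,b$ are adjacent if and only if $a=b^k$ or $b=a^k$ for some positive integer $k$. $\phi(B,x)=\det(xI-B)$ and $\phi_A(\Gamma,x)$ is the characteristic polynomial of the adjacency matrix of $\Gamma$. *)

(* Defs.v *)
From HB Require Import structures.
From mathcomp Require Import all_boot all_order all_algebra all_fingroup all_solvable.

Set Implicit Arguments.
Unset Strict Implicit.
Unset Printing Implicit Defensive.

Import GroupScope GRing.Theory.
Local Open Scope ring_scope.

Record sgraph := SGraph {
  vertex :> finType;
  edge : rel vertex;
  edge_sym : symmetric edge;
  edge_irrefl : irreflexive edge }.

(* Vertices are numbered by the canonical enumeration of the vertex type; the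
   characteristic polynomial does not depend on this choice. Coefficients are
   integers, so identities between characteristic polynomials hold in Z[x] and
   hence over every commutative ring. *)
Definition adjacency_mx (Gamma : sgraph) : 'M[int]_#|Gamma| :=
  \matrix_(i, j) (edge (enum_val i) (enum_val j))%:R.

Definition phiA (Gamma : sgraph) : {poly int} := char_poly (adjacency_mx Gamma).

Section PowerGraph.
Variable gT : finGroupType.
Implicit Types (a b : gT) (G : {group gT}).

Definition power_adj a b : Prop :=
  a <> b /\ exists k : nat, (0 < k)%N /\ (a = (b ^+ k)%g \/ b = (a ^+ k)%g).

Lemma power_of_cycle a b :
  a \in <[b]>%g -> exists k : nat, (0 < k)%N /\ a = (b ^+ k)%g.
Proof.
case/cycleP=> i ->; exists (i + #[b]%g)%N.
by rewrite addn_gt0 order_gt0 orbT expgD expg_order mulg1.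
Qed.

Lemma power_adjP a b :
  reflect (power_adj a b)
    ((a != b) && ((a \in <[b]>%g) || (b \in <[a]>%g))).
Proof.
apply: (iffP andP) => [[/eqP ab /orP[] /power_of_cycle[k [k0 e]]]|].
- by split=> //; exists k; split=> //; left.
- by split=> //; exists k; split=> //; right.
case=> /eqP ab [k [_ [e|e]]]; split=> //.
- by rewrite e mem_cycle.
- by rewrite e mem_cycle orbT.
Qed.

Definition power_adj_dec a b : decidable (power_adj a b) :=
  decP (power_adjP a b).

Definition power_edge G : rel (subg_of G) :=
  fun u v => power_adj_dec (sgval u) (sgval v).

Lemma power_edge_sym G : symmetric (@power_edge G).
Proof.
have H a b : power_adj a b -> power_adj b a.
  case=> ab [k [k0 e]]; split; first by move/esym.
  by exists k; split=> //; case: e; [right | left].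
by move=> u v; apply/sumboolP/sumboolP; apply: H.
Qed.

Lemma power_edge_irrefl G : irreflexive (@power_edge G).
Proof. by move=> u; apply/sumboolP; case. Qed.

Definition power_graph G : sgraph :=
  SGraph (@power_edge_sym G) (@power_edge_irrefl G).

End PowerGraph.

Definition mx_of_rows (r c : nat) (s : seq (seq int)) : 'M[int]_(r, c) :=
  \matrix_(i, j) (nth [::] s i)`_j.

Section QuotientMatrices.
Variables p q n m : nat.
Let P : int := p%:Z.
Let Q : int := q%:Z.

Definition T1 : 'M[int]_4 := mx_of_rows 4 4
  [:: [:: 0; P ^+ n - 1; (P ^+ n - 1) * (Q ^+ m - 1); Q ^+ m - 1];
      [:: 1; P - 2; (P - 1) * (Q ^+ m - 1); 0];
      [:: 1; P - 1; (P - 1) * (Q - 1) - 1; Q - 1];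
      [:: 1; 0; (P ^+ n - 1) * (Q - 1); Q - 2]].

Definition Tf : 'M[int]_2 := mx_of_rows 2 2
  [:: [:: P - 2; (P - 1) * (Q ^+ m - 1)];
      [:: P - 1; (P - 1) * (Q - 1) - 1]].

Definition Tg : 'M[int]_2 := mx_of_rows 2 2
  [:: [:: (P - 1) * (Q - 1) - 1; Q - 1];
      [:: (P ^+ n - 1) * (Q - 1); Q - 2]].

End QuotientMatrices.

(* Main.v *)
Require Import Defs.
From HB Require Import structures.
From mathcomp Require Import all_boot all_order all_algebra all_fingroup all_solvable.
From mathcomp Require Import ring zify.

Set Implicit Arguments.
Unset Strict Implicit.
Unset Printing Implicit Defensive.

Import GroupScope GRing.Theory.
Local Open Scope ring_scope.

(** The adjacency matrix of the power graph plus the identity is the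
    comparability matrix of the order "lies in the cyclic subgroup of" on
    [A x B]. As [p] and [q] are distinct primes, this order is the product of
    the corresponding orders on [A] and [B], so by inclusion-exclusion the matrix
    is [Z (x) Z' + Z^T (x) Z'^T - E (x) E'], where [Z] is the order matrix of a
    factor and [E] the matrix of "generates the same subgroup". On functions on
    [A], the matrices [Z], [Z^T], [E] are simultaneously block diagonal: a
    [2 x 2] block comes from the value at [1] and the sum over the other
    elements, all three act as the scalar [p - 1] on the [alpha - 1]
    differences of line sums, and as [0] on the remaining functions with zero
    sum on every line. Tensoring the decompositions of [A] and [B] gives a
    [4 x 4] block [T1^T + 1] and the blocks of size 2 and 1 in the formula. *)

(** * Determinants of matrices indexed by finite types *)

Lemma det_mx22 (R : comNzRingType) (M : 'M[R]_2) :
  \det M = M 0 0 * M 1 1 - M 0 1 * M 1 0.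
Proof.
rewrite (expand_det_row _ 0) !big_ord_recl big_ord0 /cofactor !det_mx11 !mxE /=.
have -> : lift 0 0 = 1 :> 'I_2 by apply: val_inj.
have -> : lift 1 0 = 0 :> 'I_2 by apply: val_inj.
by rewrite !exprS; ring.
Qed.

Section FinTypeDeterminant.
Variable R : comNzRingType.

Definition detF (T : finType) (F : T -> T -> R) : R :=
  \det (\matrix_(i < #|T|, j < #|T|) F (enum_val i) (enum_val j)).

Definition mulF (T : finType) (F G : T -> T -> R) (x z : T) : R :=
  \sum_y F x y * G y z.

Definition tensF (S T : finType) (F : S -> S -> R) (G : T -> T -> R)
  (u v : S * T) : R := F u.1 v.1 * G u.2 v.2.

Lemma eq_detF (T : finType) (F G : T -> T -> R) : F =2 G -> detF F = detF G.
Proof. by move=> eqFG; congr (\det _); apply/matrixP=> i j; rewrite !mxE. Qed.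

(** Two numberings of [T] differ by one permutation applied to both rows and columns, and the two
    signs cancel. *)
Lemma detF_ord (T : finType) n (h : 'I_n -> T) (F : T -> T -> R) :
  bijective h -> detF F = \det (\matrix_(i, j) F (h i) (h j)).
Proof.
move=> bij_h; have En : n = #|T| by rewrite -(bij_eq_card bij_h) card_ord.
subst n; have inj_s : injective (enum_rank \o h).
  by apply: inj_comp (bij_inj bij_h); apply: enum_rank_inj.
pose s := perm inj_s.
set M := \matrix_(i, j) F (h i) (h j).
have -> : M = row_perm s (col_perm s
    (\matrix_(i < #|T|, j < #|T|) F (enum_val i) (enum_val j))).
  by apply/matrixP=> i j; rewrite !mxE !permE /= !enum_rankK.
rewrite row_permE col_permE !det_mulmx !det_perm odd_permV.
by rewrite [X in _ * X]mulrC mulrA -expr2 sqrr_sign mul1r.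
Qed.

Lemma detF_reindex (S T : finType) (h : S -> T) (F : T -> T -> R) :
  bijective h -> detF F = detF (fun x y => F (h x) (h y)).
Proof.
move=> bij_h; rewrite (@detF_ord T #|S| (h \o @enum_val S S)) //.
exact: bij_comp bij_h (@enum_val_bij S).
Qed.

Lemma detF_mul (T : finType) (F G : T -> T -> R) :
  detF (mulF F G) = detF F * detF G.
Proof.
rewrite -det_mulmx; congr (\det _); apply/matrixP=> i j; rewrite !mxE /mulF.
rewrite (reindex (@enum_val T T)) /=; last exact/onW_bij/enum_val_bij.
by apply: eq_bigr => k _; rewrite !mxE.
Qed.

Lemma detF_sum (S T : finType) (F : S + T -> S + T -> R) :
  (forall x y, F (inl x) (inr y) = 0) ->
  detF F = detF (fun x y => F (inl x) (inl y))
           * detF (fun x y => F (inr x) (inr y)).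
Proof.
move=> F0; pose h (i : 'I_(#|S| + #|T|)) : S + T :=
  match split i with inl j => inl (enum_val j) | inr j => inr (enum_val j) end.
have bij_h : bijective h.
  exists (fun z => unsplit (match z with
    inl x => inl (enum_rank x) | inr x => inr (enum_rank x) end)).
    rewrite /h => i; rewrite -[RHS]splitK.
    by case: (split i) => j; rewrite enum_valK.
  by rewrite /h; case=> x; rewrite unsplitK enum_rankK.
rewrite (detF_ord F bij_h) -(det_lblock _ (\matrix_(i < #|T|, j < #|S|)
  F (inr (enum_val i)) (inl (enum_val j)))).
congr (\det _); apply/matrixP=> i j; rewrite !mxE /h.
by case: (split i) => i'; rewrite !mxE; case: (split j) => j'; rewrite !mxE.
Qed.

Lemma detF_block_diag (S T : finType) (H : S -> T -> T -> R) :
  detF (fun u v : S * T => (u.1 == v.1)%:R * H u.1 u.2 v.2)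
    = \prod_x detF (H x).
Proof.
have ord_case n (K : 'I_n -> T -> T -> R) :
    detF (fun u v : 'I_n * T => (u.1 == v.1)%:R * K u.1 u.2 v.2)
      = \prod_i detF (K i).
  elim: n K => [|n IHn] K.
    (* The index type is empty and [T] may be empty too, so the numbering is built from the
       contradiction [i < 0]. *)
    rewrite big_ord0 (@detF_ord _ 0 (fun i => (i, match notF (ltn_ord i) with end))).
      by rewrite det_mx00.
    exists (fun u : 'I_0 * T => u.1); first by case.
    by case=> [[]].
  pose h (z : T + 'I_n * T) : 'I_n.+1 * T :=
    match z with inl y => (ord0, y) | inr u => (lift ord0 u.1, u.2) end.
  have bij_h : bijective h.
    exists (fun u => match unlift ord0 u.1 with
      None => inl u.2 | Some i => inr (i, u.2) end).
      by case=> [y|[i y]] /=; rewrite ?unlift_none ?liftK.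
    by case=> i y /=; case: unliftP => [j|] ->.
  rewrite (detF_reindex _ bij_h) detF_sum => [|y u]; last by rewrite mul0r.
  rewrite big_ord_recl; congr (_ * _).
    by apply: eq_detF => y z; rewrite /= mul1r.
  by rewrite -IHn; apply: eq_detF => u v.
have bij_h : bijective (fun u : 'I_#|S| * T => (enum_val u.1 : S, u.2)).
  by exists (fun u => (enum_rank u.1, u.2)) => -[x y] /=;
     rewrite ?enum_rankK ?enum_valK.
rewrite (detF_reindex _ bij_h) (reindex (@enum_val S S)) /=; last first.
  exact/onW_bij/enum_val_bij.
rewrite -ord_case; apply: eq_detF => -[i y] [j z] /=.
by rewrite (inj_eq enum_val_inj).
Qed.

Lemma detF_diag (S : finType) (f : S -> R) :
  detF (fun x y : S => (x == y)%:R * f x) = \prod_x f x.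
Proof.
have bij_h : bijective (fun u : S * unit => u.1).
  by exists (fun x => (x, tt)); first by case=> x [].
rewrite (detF_reindex _ bij_h).
rewrite (detF_block_diag (fun x (_ _ : unit) => f x)); apply: eq_bigr => x _.
rewrite (@detF_ord _ 1 (fun=> tt)); last first.
  by exists (fun=> ord0); [move=> i; rewrite [i]ord1 | case].
by rewrite det_mx11 mxE.
Qed.

Lemma mulF_tensF (S T : finType) (F F' : S -> S -> R) (G G' : T -> T -> R) :
  mulF (tensF F G) (tensF F' G') =2 tensF (mulF F F') (mulF G G').
Proof.
move=> u v; rewrite /tensF /mulF big_distrlr pair_big /=.
by apply: eq_bigr => w _; rewrite mulrACA.
Qed.

(** The kernel factors as [tensF F 1] times [tensF 1 G]; each factor is block diagonal, the first
    one after exchanging the coordinates. *)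
Lemma detF_tensF (S T : finType) (F : S -> S -> R) (G : T -> T -> R) :
  detF (tensF F G) = detF F ^+ #|T| * detF G ^+ #|S|.
Proof.
pose idF (U : finType) (x y : U) : R := (x == y)%:R.
have -> : detF (tensF F G)
    = detF (mulF (tensF F (@idF T)) (tensF (@idF S) G)).
  apply: eq_detF => u v; rewrite mulF_tensF /tensF /mulF /idF.
  congr (_ * _).
    by rewrite (bigD1 v.1) //= eqxx mulr1 big1 ?addr0 // => y /negbTE->;
       rewrite mulr0.
  by rewrite (bigD1 u.2) //= eqxx mul1r big1 ?addr0 // => y;
     rewrite eq_sym => /negbTE->; rewrite mul0r.
rewrite detF_mul; congr (_ * _); last first.
  by rewrite (detF_block_diag (fun=> G)) prodr_const.
have bij_h : bijective (fun u : T * S => (u.2, u.1)).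
  by exists (fun u : S * T => (u.2, u.1)) => -[].
rewrite (detF_reindex _ bij_h) -prodr_const -(detF_block_diag (fun=> F)).
by apply: eq_detF => u v; rewrite /tensF mulrC.
Qed.

Lemma detF_bool (F : bool -> bool -> R) :
  detF F = F true true * F false false - F true false * F false true.
Proof.
have bij_h : bijective (fun i : 'I_2 => i == ord0).
  exists (fun b : bool => if b then ord0 else ord_max); last by case.
  by case=> [[|[]]] //= lt_i; apply: val_inj.
by rewrite (detF_ord _ bij_h) det_mx22 !mxE.
Qed.

End FinTypeDeterminant.

(** * Pointed sets partitioned into lines *)

(** The model is a nontrivial elementary abelian group: the origin is the identity and the key of an
    element is the cyclic subgroup it generates, so a line through [x != origin] is a set of
    generators and avoids the origin. *)
Record line_space := LineSpace {
  point :> finType;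
  key_type : eqType;
  line_of : point -> key_type;
  origin : point;
  base_point : point;
  line_size : nat;
  line_num : nat;
  base_point_neq : base_point != origin;
  line_of_origin : forall x, (line_of x == line_of origin) = (x == origin);
  card_line : forall x, x != origin ->
    #|[pred y | line_of y == line_of x]| = line_size;
  card_point : #|point| = (line_num * line_size).+1 }.

Section LineSpace.
Variables (R : idomainType) (X : line_space).
Hypothesis natr_neq0 : forall n, n.+1%:R != 0 :> R.

Local Notation o := (origin X).
Local Notation d := (line_size X).
Local Notation alpha := (line_num X).
Local Notation line := (@line_of X).

(** The pick depends on the line alone; the default is never reached, since [x] lies on its own
    line. *)
Definition line_rep (x : X) : X := odflt x [pick y | line y == line x].

Lemma line_of_rep x : line (line_rep x) = line x.
Proof. by rewrite /line_rep; case: pickP => [y /eqP | /(_ x)/eqP]. Qed.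

Lemma eq_line_rep x y : line x = line y -> line_rep x = line_rep y.
Proof.
move=> eq_xy; rewrite /line_rep eq_xy; case: pickP => //= /(_ y).
by rewrite eqxx.
Qed.

Definition base : X := line_rep (base_point X).

Lemma line_rep_id x : line_rep (line_rep x) = line_rep x.
Proof. exact/eq_line_rep/line_of_rep. Qed.

Lemma line_rep_origin x : (line_rep x == o) = (x == o).
Proof. by rewrite -!line_of_origin line_of_rep. Qed.

Lemma line_rep_base : line_rep base = base.
Proof. exact: line_rep_id. Qed.

Lemma base_neq : base != o.
Proof. by rewrite line_rep_origin base_point_neq. Qed.

Lemma line_size_gt0 : (0 < d)%N.
Proof.
by rewrite -(card_line base_neq); apply/card_gt0P; exists base; rewrite inE.
Qed.

Lemma line_num_gt0 : (0 < alpha)%N.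
Proof.
rewrite lt0n; apply/eqP=> alpha0.
have /card_le1P/(_ o isT base) : (#|X| <= 1)%N by rewrite card_point alpha0.
by rewrite !inE (negbTE base_neq).
Qed.

Lemma card_off_origin : #|[pred x : X | x != o]| = (alpha * d)%N.
Proof. by have := cardC1 o; rewrite card_point. Qed.

Lemma card_line_rep : #|[pred x : X | (x != o) && (line_rep x == x)]| = alpha.
Proof.
apply/eqP; rewrite -(eqn_pmul2r line_size_gt0); apply/eqP.
rewrite -card_off_origin -sum_nat_const -[RHS]sum1_card.
rewrite [RHS](partition_big line_rep
  [pred x | (x != o) && (line_rep x == x)]) /=.
  apply: eq_big => x; rewrite inE // => /andP[xo /eqP rx].
  rewrite -(card_line xo) -sum1_card.
  apply: eq_bigl => y; rewrite !inE; apply/eqP/andP=> [lyx | [_ /eqP<-]].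
    split; last by rewrite (eq_line_rep lyx) rx.
    by rewrite -line_of_origin lyx line_of_origin.
  by rewrite line_of_rep.
by move=> x xo; rewrite line_rep_origin [x != o]xo line_rep_id /=.
Qed.

(** [same_line], [below] and [above] are [E], [Z] and [Z^T]: in the group model, [x] lies in the
    cyclic subgroup of [y] exactly when [x] is the origin or both are on one line. *)
Definition same_line (x y : X) : R := (line x == line y)%:R.
Definition below (x y : X) : R := if x == o then 1 else same_line x y.
Definition above (x y : X) : R := if y == o then 1 else same_line x y.

Definition special (x : X) := (x == o) || (x == base).
(** The common eigenvalue of the three kernels on the functional indexed by a point that is not
    special. *)
Definition weight (x : X) : R := if line_rep x == x then d%:R else 0.

(* In the order [true, false] the index set stands for [origin, base]. *)
Definition mx2 (a b c e : R) (i j : bool) : R :=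
  if i then (if j then a else b) else (if j then c else e).
(** Row [true] expands the kernel at the origin, row [false] its sum over the other points; for
    instance [above] sums to [alpha * d] at the origin and to [d] elsewhere. *)
Definition below2 := mx2 1 1 0 d%:R.
Definition above2 := mx2 1 0 (alpha * d)%:R d%:R.
Definition same2 := mx2 1 0 0 d%:R.

Definition block (c : bool -> bool -> R) (x y : X) : R :=
  if special x then (if special y then c (x == o) (y == o) else 0)
  else (x == y)%:R * weight x.

(* The rows of this matrix are functionals on functions on [X] spanning
   subspaces that are invariant under [below], [above] and [same_line] at
   once: the value at the origin and the sum over the other points, then the
   differences between line sums (up to scaling), then the deviations of the
   value at a point from the mean over its line. *)
Definition functional (x y : X) : R :=
  if x == o then (y == o)%:R
  else if x == base then (y != o)%:R
  else if line_rep x == x then alpha%:R * same_line x y - (y != o)%:R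
  else d%:R * (x == y)%:R - same_line x y.

Lemma sum_delta (x : X) (f : X -> R) : \sum_y (x == y)%:R * f y = f x.
Proof.
rewrite (bigD1 x) //= eqxx mul1r big1 ?addr0 // => y.
by rewrite eq_sym => /negbTE->; rewrite mul0r.
Qed.

Lemma mulF_block c (F : X -> X -> R) x z :
  mulF (block c) F x z =
    if special x then c (x == o) true * F o z + c (x == o) false * F base z
    else weight x * F x z.
Proof.
rewrite /mulF /block; case: (special x); last first.
  rewrite -(sum_delta x (fun y => weight x * F y z)).
  by apply: eq_bigr => y _; rewrite mulrA.
rewrite (bigD1 o) //= (bigD1 base) ?base_neq //= /special !eqxx orbT.
rewrite (negbTE base_neq) big1 ?addr0 // => y /andP[/negbTE-> /negbTE->].
by rewrite mul0r.
Qed.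

Lemma sum_off_origin z : \sum_y (y != o)%:R * same_line y z = d%:R * (z != o)%:R.
Proof.
have [-> | zo] := eqVneq z o.
  rewrite mulr0 big1 // => y _; rewrite /same_line line_of_origin.
  by case: eqP; rewrite (mul0r, mulr0).
rewrite mulr1 -(card_line zo) -sum1_card natr_sum [RHS]big_mkcond /=.
apply: eq_bigr => y _; rewrite inE /same_line.
case: (line y =P line z) => [eq_yz|]; rewrite ?mulr0 // mulr1.
by rewrite -line_of_origin eq_yz line_of_origin zo.
Qed.

Lemma sum_line x (f : X -> R) : x != o ->
  (forall y, line y = line x -> f y = f x) ->
  \sum_y same_line x y * f y = d%:R * f x.
Proof.
move=> xo fE; rewrite -(card_line xo) -sum1_card natr_sum big_distrl.
rewrite [RHS]big_mkcond /=.
apply: eq_bigr => y _; rewrite inE /same_line eq_sym.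
by case: eqP => [/fE->|]; rewrite ?mul0r.
Qed.

(* The correction [s] is [0] for [below] and [same_line], and the indicator of
   the origin for [above]. *)
Lemma mulF_functional (F : X -> X -> R) (s : X -> R) :
    (forall y z, y != o -> F y z = same_line y z + s z) ->
  forall x z, mulF functional F x z =
    if x == o then F o z
    else if x == base then d%:R * (z != o)%:R + (alpha * d)%:R * s z
    else weight x * functional x z.
Proof.
move=> FE x z; rewrite /mulF /functional.
have sum_off : \sum_y (y != o)%:R * F y z
    = d%:R * (z != o)%:R + (alpha * d)%:R * s z.
  rewrite -sum_off_origin -card_off_origin -sum1_card natr_sum big_distrl.
  rewrite [X in _ + X]big_mkcond /=.
  rewrite -big_split; apply: eq_bigr => y _ /=; rewrite inE.
  case: eqVneq => [_|/FE->]; rewrite ?mul0r ?addr0 // !mul1r //.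
have [xo|xo] := eqVneq x o.
  under eq_bigr do rewrite eq_sym.
  by rewrite sum_delta.
have [xb|xb] := eqVneq x base; first exact: sum_off.
have sumF : \sum_y same_line x y * F y z = d%:R * (same_line x z + s z).
  rewrite -FE // sum_line // => y lyx; have yo : y != o.
    by rewrite -line_of_origin lyx line_of_origin.
  by rewrite !FE // /same_line lyx.
(* The correction [s z] cancels in both cases, leaving the eigenvalue [d] at a representative and
   [0] elsewhere. *)
rewrite /weight; case: ifP => _.
  under eq_bigr do rewrite mulrBl -mulrA.
  rewrite sumrB -big_distrr /= sumF sum_off natrM; ring.
under eq_bigr do rewrite mulrBl -mulrA.
rewrite sumrB -big_distrr /= sumF sum_delta FE //; ring.
Qed.

Lemma functional_below : mulF functional below =2 mulF (block below2) functional.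
Proof.
move=> x z; rewrite (mulF_functional (s := fun=> 0)); last first.
  by move=> y w /negbTE yo; rewrite /below yo addr0.
rewrite mulF_block /special /below2 /mx2.
have [xo|xo] /= := eqVneq x o.
  rewrite /below /functional !eqxx (negbTE base_neq).
  by case: (z == o); rewrite /= ?mul1r ?addr0 ?add0r.
have [xb|xb] //= := eqVneq x base.
by rewrite /functional eqxx (negbTE base_neq) mulr0 mul0r addr0 add0r eqxx.
Qed.

Lemma functional_above : mulF functional above =2 mulF (block above2) functional.
Proof.
move=> x z; rewrite (mulF_functional (s := fun z => (z == o)%:R)); last first.
  move=> y w yo; rewrite /above /same_line.
  case: (eqVneq w o) => [->|_]; last by rewrite addr0.
  by rewrite line_of_origin (negbTE yo) add0r.
rewrite mulF_block /special /above2 /mx2.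
have [xo|xo] /= := eqVneq x o.
  rewrite /above /functional !eqxx (negbTE base_neq) /same_line.
  rewrite [line o == _]eq_sym line_of_origin.
  by case: (z == o); rewrite /= ?mul1r ?mul0r ?addr0.
have [xb|xb] //= := eqVneq x base.
by rewrite /functional eqxx (negbTE base_neq) eqxx addrC.
Qed.

Lemma functional_same : mulF functional same_line =2 mulF (block same2) functional.
Proof.
move=> x z; rewrite (mulF_functional (s := fun=> 0)); last first.
  by move=> y w _; rewrite addr0.
rewrite mulF_block /special /same2 /mx2.
have [xo|xo] /= := eqVneq x o.
  rewrite /functional !eqxx /same_line.
  rewrite [line o == _]eq_sym line_of_origin.
  by rewrite mul1r mul0r addr0.
have [xb|xb] //= := eqVneq x base.
by rewrite /functional eqxx (negbTE base_neq) mulr0 mul0r addr0 add0r eqxx.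
Qed.

(** The values are recovered in stages: the origin and the total over the other points, the line
    sums, the points that are not representatives, and last the representatives. Characteristic zero
    allows cancelling [alpha] and [d]. *)
Lemma functional_inj (f : X -> R) :
  (forall x, \sum_y functional x y * f y = 0) -> forall x, f x = 0.
Proof.
move=> f0.
have fo : f o = 0.
  rewrite -[RHS](f0 o) /functional eqxx.
  by under eq_bigr do rewrite eq_sym; rewrite sum_delta.
have sum0 : \sum_y (y != o)%:R * f y = 0.
  by rewrite -[RHS](f0 base) /functional (negbTE base_neq) eqxx.
have d_neq0 : d%:R != 0 :> R by case: (d) line_size_gt0.
have alpha_neq0 : alpha%:R != 0 :> R by case: (alpha) line_num_gt0.
pose S x := \sum_y same_line x y * f y.
have S_line x y : line x = line y -> S x = S y.
  by move=> lxy; rewrite /S /same_line lxy.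
have S_rep x : x != o -> x != base -> line_rep x = x -> S x = 0.
  move=> xo xb rx; apply/eqP; rewrite -(mulrI_eq0 _ (mulfI alpha_neq0)).
  rewrite -[X in _ == X](f0 x) /functional (negbTE xo) (negbTE xb) rx eqxx.
  under [X in _ == X]eq_bigr do rewrite mulrBl -mulrA.
  by rewrite sumrB sum0 subr0 -big_distrr.
have S_base : S base = 0.
  (* the sum over the points off the origin is the sum of the line sums *)
  rewrite -sum0; have -> : \sum_y (y != o)%:R * f y = \sum_(y | y != o) f y.
    rewrite [RHS]big_mkcond; apply: eq_bigr => y _.
    by case: (y == o); rewrite (mul0r, mul1r).
  rewrite (partition_big line_rep [pred x | (x != o) && (line_rep x == x)]) /=;
    last by move=> x xo; rewrite line_rep_origin [x != o]xo line_rep_id /=.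
  have SE x : x != o -> line_rep x = x ->
      \sum_(y | (y != o) && (line_rep y == x)) f y = S x.
    move=> xo rx; rewrite big_mkcond; apply: eq_bigr => y _; rewrite /same_line.
    have -> : (y != o) && (line_rep y == x) = (line x == line y).
      apply/andP/eqP=> [[_ /eqP<-]|lxy]; first by rewrite line_of_rep.
      by rewrite -(eq_line_rep lxy) rx -line_of_origin -lxy line_of_origin.
    by case: eqP; rewrite ?mul0r ?mul1r.
  rewrite (bigD1 base) ?base_neq ?line_rep_base ?eqxx //=.
  rewrite SE ?base_neq ?line_rep_base // big1 ?addr0 // => x.
  by case/andP=> /andP[xo /eqP rx] xb; rewrite SE ?S_rep.
have S0 x : x != o -> S x = 0.
  move=> xo; rewrite -(S_line _ _ (line_of_rep x)).
  have [->//|rb] := eqVneq (line_rep x) base.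
  by apply: S_rep; rewrite ?line_rep_origin ?line_rep_id.
have f_nonrep x : line_rep x != x -> f x = 0.
  move=> rx; have [->//|xo] := eqVneq x o.
  have xb : x != base by apply: contraNneq rx => ->; rewrite line_rep_base.
  apply/eqP; rewrite -(mulrI_eq0 _ (mulfI d_neq0)).
  rewrite -[X in _ == X](f0 x) /functional (negbTE xo) (negbTE xb) (negbTE rx).
  under [X in _ == X]eq_bigr do rewrite mulrBl -mulrA.
  by rewrite sumrB -big_distrr /= sum_delta [X in _ - X]S0 ?subr0.
move=> x; have [rx|] := eqVneq (line_rep x) x; last exact: f_nonrep.
(* A representative is the only point of its line not yet known to have value [0], so its value is
   the line sum. *)
have [->//|xo] := eqVneq x o; rewrite -(S0 x xo) /S (bigD1 x) //= /same_line.
rewrite eqxx mul1r big1 ?addr0 // => y yx; case: eqP => [lxy|]; last first.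
  by rewrite mul0r.
by rewrite f_nonrep ?mulr0 // -(eq_line_rep lxy) rx eq_sym.
Qed.

Lemma detF_functional : detF functional != 0.
Proof.
rewrite /detF -det_tr; apply/det0P => -[v v_neq0 vM]; case/eqP: v_neq0.
have f0 := @functional_inj (fun x => v 0 (enum_rank x)).
apply/rowP=> i; rewrite mxE -[i]enum_valK f0 // => x.
have /rowP/(_ (enum_rank x)) := vM; rewrite !mxE.
apply: etrans; rewrite (reindex (@enum_val X X)) /=; last exact/onW_bij/enum_val_bij.
by apply: eq_bigr => j _; rewrite !mxE enum_valK enum_rankK mulrC.
Qed.

(** Off the origin and [base] there remain [alpha - 1] representatives, of weight [d], and
    [alpha * (d - 1)] other points, of weight [0]. *)
Lemma prod_weight (h : R -> R) :
  \prod_(x | ~~ special x) h (weight x)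
    = h d%:R ^+ (alpha - 1) * h 0 ^+ (alpha * (d - 1)).
Proof.
have card1 : #|[pred x : X | ~~ special x && (line_rep x == x)]|
    = (alpha - 1)%N.
  rewrite -card_line_rep [in RHS](cardD1 base) !inE base_neq line_rep_base eqxx.
  rewrite addKn; apply: eq_card => x; rewrite !inE /special negb_or.
  by rewrite andbA [(x != base) && _]andbC.
have card2 : #|[pred x : X | ~~ special x && (line_rep x != x)]|
    = (alpha * (d - 1))%N.
  rewrite mulnBr muln1 -card_off_origin -card_line_rep.
  rewrite -(cardID [pred x : X | line_rep x == x] [pred x | x != o]).
  have -> : #|[predI [pred x : X | x != o] & [pred x | line_rep x == x]]|
      = #|[pred x : X | (x != o) && (line_rep x == x)]|.
    by apply: eq_card => x; rewrite !inE.
  rewrite addKn; apply: eq_card => x; rewrite !inE /special negb_or andbC.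
  case: (eqVneq x base) => [->|_]; first by rewrite line_rep_base eqxx.
  by rewrite andbT.
rewrite (bigID (fun x => line_rep x == x)) /= -{1}card1 -card2.
rewrite -!prodr_const; congr (_ * _); apply: eq_big => x; rewrite ?inE //.
  by case/andP=> _ rx; rewrite /weight rx.
by case/andP=> _ /negbTE rx; rewrite /weight rx.
Qed.

End LineSpace.

(** * Characteristic kernels of inclusion-exclusion sums *)

Section ShiftedKernel.
Variables (R : comNzRingType) (T : finType) (t : R).

(** [C] plays the intersection of the relations [A] and [B]; [t] will be ['X + 1]. *)
Definition shiftF (A B C : T -> T -> R) (u v : T) : R :=
  t * (u == v)%:R - (A u v + B u v - C u v).

Lemma mulF_shiftr (Q A B C : T -> T -> R) u v :
  mulF Q (shiftF A B C) u v =
    t * Q u v - (mulF Q A u v + mulF Q B u v - mulF Q C u v).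
Proof.
rewrite /mulF -big_split -sumrB.
have -> : t * Q u v = \sum_y Q u y * (t * (y == v)%:R).
  rewrite (bigD1 v) //= eqxx mulr1 big1 ?addr0 1?mulrC //.
  by move=> y /negbTE->; rewrite !mulr0.
by rewrite -sumrB; apply: eq_bigr => y _ /=; rewrite /shiftF; ring.
Qed.

Lemma mulF_shiftl (Q A B C : T -> T -> R) u v :
  mulF (shiftF A B C) Q u v =
    t * Q u v - (mulF A Q u v + mulF B Q u v - mulF C Q u v).
Proof.
rewrite /mulF -big_split -sumrB.
have -> : t * Q u v = \sum_y (t * (u == y)%:R) * Q y v.
  rewrite (bigD1 u) //= eqxx mulr1 big1 ?addr0 //.
  by move=> y; rewrite eq_sym => /negbTE->; rewrite mulr0 mul0r.
by rewrite -sumrB; apply: eq_bigr => y _ /=; rewrite /shiftF; ring.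
Qed.

End ShiftedKernel.

(** * The comparability kernel of a product of two line spaces *)

Section ProductKernel.
Variables (R : idomainType) (X Y : line_space) (t : R).
Hypothesis natr_neq0 : forall n, n.+1%:R != 0 :> R.

Local Notation d := (line_size X).
Local Notation e := (line_size Y).
Local Notation alpha := (line_num X).
Local Notation beta := (line_num Y).

Definition comparability_kernel : X * Y -> X * Y -> R :=
  shiftF t (tensF (@below R X) (@below R Y)) (tensF (@above R X) (@above R Y))
    (tensF (@same_line R X) (@same_line R Y)).

Definition line_le (Z : line_space) (x y : Z) :=
  (x == origin Z) || (line_of x == line_of y).

(** Guarding the line test by the origin tests leaves only consistent cases in the boolean case
    analysis of [comparability_kernelE]. *)
Lemma eq_lineE (Z : line_space) (x y : Z) :
  (line_of x == line_of y) =
    if x == origin Z then y == origin Z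
    else (y != origin Z) && (line_of x == line_of y).
Proof.
have [->|xo] := eqVneq x (origin Z); first by rewrite eq_sym line_of_origin.
have [->|//] := eqVneq y (origin Z).
by rewrite line_of_origin (negbTE xo).
Qed.

(* Two points of the product are comparable both ways exactly when their
   lines agree, whence the inclusion-exclusion form of the kernel. *)
Lemma comparability_kernelE (u v : X * Y) :
  comparability_kernel u v = t * (u == v)%:R
    - (line_le u.1 v.1 && line_le u.2 v.2
       || line_le v.1 u.1 && line_le v.2 u.2)%:R.
Proof.
rewrite /comparability_kernel /shiftF /tensF /below /above /same_line /line_le.
rewrite [line_of v.1 == _]eq_sym [line_of v.2 == _]eq_sym.
rewrite (eq_lineE u.1 v.1) (eq_lineE u.2 v.2); congr (_ - _).
case: (u.1 == _); case: (v.1 == _); case: (u.2 == _); case: (v.2 == _) => /=;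
case: (line_of u.1 == line_of v.1); case: (line_of u.2 == line_of v.2) => /=;
ring.
Qed.

Definition block_kernel : X * Y -> X * Y -> R :=
  shiftF t (tensF (block (below2 R X)) (block (below2 R Y)))
    (tensF (block (above2 R X)) (block (above2 R Y)))
    (tensF (block (same2 R X)) (block (same2 R Y))).

Definition small_kernel : bool * bool -> bool * bool -> R :=
  shiftF t (tensF (below2 R X) (below2 R Y)) (tensF (above2 R X) (above2 R Y))
    (tensF (same2 R X) (same2 R Y)).

(** The tensor product [Q] of the two matrices of functionals intertwines the kernels, and over a
    domain the nonzero [detF Q] can be cancelled. *)
Lemma detF_comparability_block :
  detF comparability_kernel = detF block_kernel.
Proof.
pose Q := tensF (@functional R X) (@functional R Y).
have Q_neq0 : detF Q != 0.
  by rewrite detF_tensF mulf_neq0 // expf_neq0 // detF_functional.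
apply: (mulfI Q_neq0); rewrite -detF_mul mulrC -detF_mul.
apply: eq_detF => u v; rewrite mulF_shiftr mulF_shiftl !mulF_tensF /tensF.
by rewrite !functional_below !functional_above !functional_same.
Qed.

Definition special_point (Z : line_space) (b : bool) : Z :=
  if b then origin Z else base Z.

Lemma special_pointP (Z : line_space) b : special (special_point Z b).
Proof. by case: b; rewrite /special eqxx ?orbT. Qed.

Lemma special_point_origin (Z : line_space) b :
  (special_point Z b == origin Z) = b.
Proof. by case: b; rewrite ?eqxx //; apply/negbTE/base_neq. Qed.

Lemma special_pointK (Z : line_space) (x : Z) :
  special x -> special_point Z (x == origin Z) = x.
Proof. by rewrite /special; case: eqP => [->|_ /eqP->]. Qed.

Lemma block_special (Z : line_space) (c : bool -> bool -> R) b b' :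
  block c (special_point Z b) (special_point Z b') = c b b'.
Proof. by rewrite /block !special_pointP !special_point_origin. Qed.

Lemma block_special_other (Z : line_space) (c : bool -> bool -> R) b (x : Z) :
  ~~ special x -> block c (special_point Z b) x = 0.
Proof. by move=> /negbTE xs; rewrite /block special_pointP xs. Qed.

Lemma block_other (Z : line_space) (c : bool -> bool -> R) (x y : Z) :
  ~~ special x -> block c x y = (x == y)%:R * weight R x.
Proof. by move=> /negbTE xs; rewrite /block xs. Qed.

(** On a functional of the other factor that is not special, all three kernels act by the same
    scalar [l], so fixing it leaves a block of size 2. *)
Lemma detF_weighted_block (Z : line_space) (l : R) :
  detF (shiftF t (fun b b' => l * below2 R Z b b')
                 (fun b b' => l * above2 R Z b b')
                 (fun b b' => l * same2 R Z b b'))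
  = (t - l) * (t - l * (line_size Z)%:R)
    - l ^+ 2 * (line_num Z * line_size Z)%:R.
Proof. rewrite detF_bool /shiftF /below2 /above2 /same2 /mx2 /=; ring. Qed.

(** The index pairs fall into four kinds, according to which coordinates are special; they give one
    4 x 4 block, two families of 2 x 2 blocks and a diagonal part. *)
Lemma detF_block_kernel :
  detF block_kernel = detF small_kernel
    * ((t - e%:R) * (t - e%:R * d%:R)
       - e%:R ^+ 2 * (alpha * d)%:R) ^+ (beta - 1)
    * ((t - d%:R) * (t - d%:R * e%:R)
       - d%:R ^+ 2 * (beta * e)%:R) ^+ (alpha - 1)
    * (t - d%:R * e%:R) ^+ ((alpha - 1) * (beta - 1))
    * t ^+ ((alpha * d).+1 * (beta * e).+1 - (alpha + 1) * (beta + 1)).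
Proof.
pose J := {x in [pred x : X | ~~ special x]}.
pose J' := {y in [pred y : Y | ~~ special y]}.
pose h (z : (bool * bool + J' * bool) + (J * bool + J * J')) : X * Y :=
  match z with
  | inl (inl u) => (special_point X u.1, special_point Y u.2)
  | inl (inr u) => (special_point X u.2, val u.1)
  | inr (inl u) => (val u.1, special_point Y u.2)
  | inr (inr u) => (val u.1, val u.2)
  end.
have valJ (j : J) : ~~ special (val j) by have := valP j; rewrite inE.
have valJ' (j : J') : ~~ special (val j) by have := valP j; rewrite inE.
have bij_h : bijective h.
  pose h' (u : X * Y) : (bool * bool + J' * bool) + (J * bool + J * J') :=
    match insub u.1, insub u.2 with
    | None, None => inl (inl (u.1 == origin X, u.2 == origin Y))
    | None, Some j' => inl (inr (j', u.1 == origin X))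
    | Some j, None => inr (inl (j, u.2 == origin Y))
    | Some j, Some j' => inr (inr (j, j'))
    end.
  have insubNs (Z : line_space) b :
      insub (special_point Z b) = None
        :> option {x in [pred x : Z | ~~ special x]}.
    by apply: insubN; rewrite inE negbK special_pointP.
  exists h'.
    case=> [[[b b']|[j' b]]|[[j b']|[j j']]]; rewrite /h' /= ?insubNs ?valK //=;
    by rewrite ?special_point_origin.
  case=> x y; rewrite /h' /=.
  case: insubP => [j _ <-|]; case: insubP => [j' _ <-|] //=.
  - by rewrite inE negbK => /special_pointK->.
  - by rewrite inE negbK => /special_pointK->.
  by rewrite !inE !negbK => /special_pointK-> /special_pointK->.
rewrite (detF_reindex _ bij_h) detF_sum; last first.
  move=> [[b b']|[j' b]] [[i c]|[i i']];
  rewrite /block_kernel /shiftF /tensF /= !(@block_special_other X) ?valJ //;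
  rewrite !mul0r xpair_eqE; case: eqP => [E|_] /=; rewrite ?mulr0 ?addr0 ?subr0 //;
  by have := valJ i; rewrite /= -E special_pointP.
rewrite !detF_sum /=; first last.
- move=> [b b'] [j' b'']; rewrite /block_kernel /shiftF /tensF /=.
  rewrite !(@block_special_other Y) ?valJ' // !mulr0 xpair_eqE andbC.
  case: eqP => [E|_] /=; rewrite ?mulr0 ?addr0 ?subr0 //.
  by have := valJ' j'; rewrite /= -E special_pointP.
- move=> [b b'] [j j']; rewrite /block_kernel /shiftF /tensF /=.
  rewrite !(@block_special_other Y) ?valJ' // !mulr0 xpair_eqE andbC.
  case: eqP => [E|_] /=; rewrite ?mulr0 ?addr0 ?subr0 //.
  by have := valJ' j'; rewrite /= -E special_pointP.
have special_inj (Z : line_space) : injective (special_point Z).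
  by move=> b b' E; rewrite -[b](special_point_origin Z) E special_point_origin.
have -> : detF (fun u v : bool * bool =>
    block_kernel (special_point X u.1, special_point Y u.2)
                 (special_point X v.1, special_point Y v.2)) = detF small_kernel.
  apply: eq_detF => u v; rewrite /block_kernel /small_kernel /shiftF /tensF /=.
  rewrite !block_special xpair_eqE !(inj_eq (@special_inj _)) -xpair_eqE.
  by rewrite -!surjective_pairing.
have prodJ (Z : line_space) (k : R -> R) :
    \prod_(j : {x in [pred x : Z | ~~ special x]}) k (weight R (val j))
      = k (line_size Z)%:R ^+ (line_num Z - 1)
        * k 0 ^+ (line_num Z * (line_size Z - 1)).
  rewrite -(big_sub [pred x : Z | ~~ special x] (fun x => k (weight R x))).
  by rewrite -prod_weight; apply: eq_bigl => x; rewrite inE.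
pose wdet (Z : line_space) (l : R) := (t - l) * (t - l * (line_size Z)%:R)
    - l ^+ 2 * (line_num Z * line_size Z)%:R.
have -> : detF (fun u v : J' * bool =>
    block_kernel (special_point X u.2, val u.1)
                 (special_point X v.2, val v.1))
    = \prod_(j : J') wdet X (weight R (val j)).
  rewrite /wdet; under eq_bigr do rewrite -detF_weighted_block.
  rewrite -detF_block_diag; apply: eq_detF => -[j b] [j' b'].
  rewrite /block_kernel /shiftF /tensF /= !block_special !block_other ?valJ' //.
  by rewrite xpair_eqE (inj_eq (@special_inj _)) (inj_eq val_inj);
     case: (j == j'); rewrite ?andbT ?andbF /=; ring.
have -> : detF (fun u v : J * bool =>
    block_kernel (val u.1, special_point Y u.2)
                 (val v.1, special_point Y v.2))
    = \prod_(j : J) wdet Y (weight R (val j)).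
  rewrite /wdet; under eq_bigr do rewrite -detF_weighted_block.
  rewrite -detF_block_diag; apply: eq_detF => -[j b] [j' b'].
  rewrite /block_kernel /shiftF /tensF /= !block_special !block_other ?valJ //.
  by rewrite xpair_eqE (inj_eq (@special_inj _)) (inj_eq val_inj);
     case: (j == j'); rewrite /=; ring.
have -> : detF (fun u v : J * J' =>
    block_kernel (val u.1, val u.2) (val v.1, val v.2))
    = \prod_(j : J) \prod_(j' : J') (t - weight R (val j) * weight R (val j')).
  rewrite pair_bigA -detF_diag; apply: eq_detF => -[i i'] [j j'].
  rewrite /block_kernel /shiftF /tensF /= !block_other ?valJ ?valJ' //.
  rewrite !xpair_eqE !(inj_eq val_inj).
  by case: (i == j); case: (i' == j'); rewrite /=; ring.
under [X in _ * (_ * X)]eq_bigr do rewrite (prodJ Y (fun l => t - _ * l)).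
rewrite (prodJ X (fun l => (t - l * _) ^+ _ * (t - l * _) ^+ _)).
rewrite !prodJ /wdet !mul0r !mulr0 !subr0 expr0n /= mul0r !subr0.
have := line_size_gt0 X; have := line_size_gt0 Y.
have := line_num_gt0 X; have := line_num_gt0 Y.
case: (d) => // d'; case: (e) => // e'; case: (alpha) => // a'.
case: (beta) => // b' _ _ _ _.
rewrite !subn1 /=.
(* The exponent of [t] collects the zero weights: two for each point of weight [0] in the mixed
   families, and one for each pair in [J * J'] in which some weight is [0]. *)
have -> : ((a'.+1 * d'.+1).+1 * (b'.+1 * e'.+1).+1 - (a'.+1 + 1) * (b'.+1 + 1)
    = 2 * (b'.+1 * e') + 2 * (a'.+1 * d') + (b'.+1 * e') * a'
      + b' * (a'.+1 * d') + (b'.+1 * e') * (a'.+1 * d'))%N.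
  by apply/eqP; rewrite -(eqn_add2r ((a'.+1 + 1) * (b'.+1 + 1))) subnK; nia.
rewrite !mul0r subr0 -expr2 !exprMn -!exprM !exprD [(a' * b')%N]mulnC.
ring.
Qed.

End ProductKernel.

(** * Elementary abelian groups as line spaces *)

Section ElementaryAbelian.
Variables (gT : finGroupType) (p n : nat) (A : {group gT}).
Hypotheses (p_prime : prime p) (n_gt0 : (0 < n)%N).
Hypotheses (A_elem : p.-abelem A) (A_card : #|A| = (p ^ n)%N).

(** When [x] is nontrivial both cyclic subgroups have order [p], so inclusion forces equality. *)
Lemma mem_cycle_abelem x y : x \in A -> y \in A ->
  (x \in <[y]>%g) = (x == 1%g) || (<[x]>%g == <[y]>%g).
Proof.
move=> Ax Ay; have [->|x1] := eqVneq x 1%g; first by rewrite group1.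
apply/idP/eqP=> [xy|<-]; last exact: cycle_id.
have y1 : y != 1%g.
  by apply: contraNneq x1 => y1; move: xy; rewrite y1 cycle1 inE.
apply/eqP; rewrite eqEcard cycle_subG xy -!orderE.
by rewrite !(abelem_order_p A_elem) /=.
Qed.

Definition subg_cycle (u : subg_of A) : {set gT} := <[sgval u]>%g.

(** The default is never taken, as [A] has [p ^ n > 1] elements. *)
Definition subg_base : subg_of A := odflt 1%g [pick u | u != 1%g].

Lemma card_subg_of : #|subg_of A| = #|A|.
Proof. by rewrite card_sub; apply: eq_card => x; rewrite !inE. Qed.

Lemma sgval_eq1 (u : subg_of A) : (sgval u == 1%g) = (u == 1%g).
Proof. by rewrite -(inj_eq val_inj). Qed.

Lemma subg_base_neq1 : subg_base != 1%g.
Proof.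
rewrite /subg_base; case: pickP => //= all1.
suff : (#|subg_of A| <= 1)%N.
  by rewrite card_subg_of A_card leqNgt -(exp1n n) ltn_exp2r ?prime_gt1.
by apply/card_le1P => x _ y; have := all1 x; have := all1 y;
   rewrite !inE => /negbFE/eqP-> /negbFE/eqP->; rewrite eqxx.
Qed.

Lemma subg_cycle_eq1 u : (subg_cycle u == subg_cycle 1%g) = (u == 1%g).
Proof. by rewrite /subg_cycle /= cycle1 -sgval_eq1 -cycle_eq1. Qed.

(** The fibre consists of the generators of a cyclic group of order [p], counted by the totient. *)
Lemma card_subg_cycle u : u != 1%g ->
  #|[pred v | subg_cycle v == subg_cycle u]| = (p - 1)%N.
Proof.
move=> u1; have u_p : #[sgval u]%g = p.
  by apply: (abelem_order_p A_elem); rewrite ?subgP ?sgval_eq1.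
rewrite subn1 -(totient_prime p_prime) -u_p totient_gen.
rewrite -(card_imset _ val_inj); apply: eq_card => x; rewrite inE /generator.
apply/imsetP/eqP=> [[v]|ux]; first by rewrite inE => /eqP/esym uv ->.
have Ax : x \in A.
  by rewrite -cycle_subG -ux cycle_subG subgP.
by exists (subg A x); rewrite ?inE /subg_cycle /= subgK // ux.
Qed.

Lemma card_subg_lines :
  #|subg_of A| = ((p ^ n - 1) %/ (p - 1) * (p - 1)).+1%N.
Proof.
rewrite card_subg_of A_card divnK ?subn1 ?prednK ?expn_gt0 ?prime_gt0 //.
by rewrite predn_exp dvdn_mulr.
Qed.

Definition abelem_line_space : line_space :=
  LineSpace subg_base_neq1 subg_cycle_eq1 card_subg_cycle card_subg_lines.

End ElementaryAbelian.

Lemma natr_poly_int_neq0 k : k.+1%:R != 0 :> {poly int}.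
Proof. by rewrite -polyC_natr polyC_eq0 Num.Theory.pnatr_eq0. Qed.

Lemma char_poly_detF (T : finType) (F : T -> T -> int) :
  char_poly (\matrix_(i < #|T|, j < #|T|) F (enum_val i) (enum_val j))
    = detF (fun x y => (x == y)%:R * 'X - (F x y)%:P).
Proof.
congr (\det _); apply/matrixP=> i j; rewrite !mxE (inj_eq enum_val_inj).
by rewrite mulr_natl.
Qed.

(** * Cyclic subgroups of a coprime direct product *)

Section DirectProduct.
Variables (gT : finGroupType) (A B G : {group gT}).
Hypotheses (G_dprod : (A \x B)%g = G) (coAB : coprime #|A| #|B|).

Definition dprod_pair (u : subg_of A * subg_of B) : subg_of G :=
  subg G (sgval u.1 * sgval u.2)%g.

Lemma sgval_dprod_pair u :
  sgval (dprod_pair u) = (sgval u.1 * sgval u.2)%g.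
Proof.
have [_ defG _ _] := dprodP G_dprod.
by rewrite /dprod_pair subgK // -defG mem_mulg ?subgP.
Qed.

Lemma dprod_mul_inj a a' b b' : a \in A -> a' \in A -> b \in B -> b' \in B ->
  (a * b = a' * b')%g -> a = a' /\ b = b'.
Proof.
move=> Aa Aa' Bb Bb' E.
have Gab : (a * b)%g \in G.
  by have [_ <- _ _] := dprodP G_dprod; rewrite mem_mulg.
have [y [z [_ _ _ uniq_yz]]] := mem_dprod G_dprod Gab.
have [-> ->] := uniq_yz _ _ Aa Bb (erefl _).
by have [-> ->] := uniq_yz _ _ Aa' Bb' E.
Qed.

Lemma dprod_pair_bij : bijective dprod_pair.
Proof.
apply: inj_card_bij; last first.
  by rewrite card_prod !card_subg_of (dprod_card G_dprod).
move=> [u v] [u' v'] /(congr1 sgval); rewrite !sgval_dprod_pair /=.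
by case/dprod_mul_inj; rewrite ?subgP // => /val_inj-> /val_inj->.
Qed.

(** As [a'] and [b'] commute and have coprime orders, the cycle of their product is the product of
    their cycles; uniqueness of factors then separates the two conditions. *)
Lemma mem_cycle_dprod a a' b b' : a \in A -> a' \in A -> b \in B -> b' \in B ->
  ((a * b)%g \in <[a' * b']>%g) = (a \in <[a']>%g) && (b \in <[b']>%g).
Proof.
move=> Aa Aa' Bb Bb'; have [_ _ cAB _] := dprodP G_dprod.
rewrite cycleM; first last.
- by apply: coprime_dvdl (order_dvdG Aa') (coprime_dvdr (order_dvdG Bb') coAB).
- by apply/esym; exact: (centsP cAB).
apply/mulsgP/andP=> [[a1 b1 a1P b1P]|[aP bP]]; last by exists a b.
have sA : <[a']>%g \subset A by rewrite cycle_subG.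
have sB : <[b']>%g \subset B by rewrite cycle_subG.
by case/dprod_mul_inj=> //;
  [exact: subsetP a1P | exact: subsetP b1P | move=> -> ->].
Qed.

End DirectProduct.

(** * The power graph and the quotient matrices *)

Lemma power_edgeE (gT : finGroupType) (G : {group gT}) (u v : subg_of G) :
  power_edge u v = (u != v) && ((sgval u \in <[sgval v]>%g)
                               || (sgval v \in <[sgval u]>%g)).
Proof.
rewrite -(inj_eq val_inj); apply/sumboolP/idP=> [/power_adjP|] //.
by move/power_adjP.
Qed.

Lemma natr_pred_expn (R : nzRingType) (k p n : nat) :
  k.+1 = (p ^ n)%N -> k%:R = p%:R ^+ n - 1 :> R.
Proof. by move=> kE; rewrite -natrX -kE -addn1 natrD addrK. Qed.

Lemma polyC_Posz (k : nat) : (k%:Z)%:P = k%:R :> {poly int}.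
Proof. by rewrite -polyC_natr natz. Qed.

(** Entry [(i, j)] of [T1] counts the neighbours in class [j] of a vertex of class [i], whereas the
    functionals sum over the class of the row; hence a transpose. The shift by 1 accounts for the
    vertex itself. *)
Lemma det_small_kernel (p q n m : nat) (X Y : line_space) :
    (0 < p)%N -> (0 < q)%N ->
    line_size X = (p - 1)%N -> line_size Y = (q - 1)%N ->
    (line_num X * line_size X).+1 = (p ^ n)%N ->
    (line_num Y * line_size Y).+1 = (q ^ m)%N ->
  detF (small_kernel X Y ('X + 1 : {poly int})) = char_poly (T1 p q n m).
Proof.
move=> p_gt0 q_gt0 dX dY cX cY.
(* The order of the rows of [T1]: the identity, the rest of [A], products of two nontrivial factors,
   the rest of [B]. *)
pose h (i : 'I_4) : bool * bool :=
  nth (true, true)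
    [:: (true, true); (false, true); (false, false); (true, false)] i.
have bij_h : bijective h.
  apply: inj_card_bij; last by rewrite card_prod card_bool card_ord.
  by case=> [[|[|[|[|i]]]] lt_i] // [[|[|[|[|j]]]] lt_j] // _; apply: val_inj.
have PE := natr_pred_expn {poly int} cX.
have QE := natr_pred_expn {poly int} cY.
(* entry by entry, the kernel is the transpose of [char_poly_mx (T1 p q n m)] *)
rewrite (detF_ord _ bij_h) -det_tr; congr (\det _); apply/matrixP=> i j.
rewrite !mxE.
case: i j => [[|[|[|[|i]]]] lt_i] // [[|[|[|[|j]]]] lt_j] //=;
rewrite /small_kernel /shiftF /tensF /h /= /below2 /above2 /same2 /mx2;
rewrite ?PE ?QE ?dX ?dY;
rewrite ?natrB // ?(polyCM, polyCB, polyCD, polyCN, rmorphXn) /= ?polyC_Posz //;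
ring.
Qed.

Lemma char_poly_mx22 (M : 'M[int]_2) :
  char_poly M = ('X - (M 0 0)%:P) * ('X - (M 1 1)%:P) - (M 0 1 * M 1 0)%:P.
Proof.
by rewrite /char_poly det_mx22 !mxE /= polyCM; ring.
Qed.

Theorem theorem4p7 (p q n m : nat) (gT : finGroupType) (A B G : {group gT})
    (p_prime : prime p) (q_prime : prime q) (p_neq_q : p <> q)
    (n_gt0 : (0 < n)%N) (m_gt0 : (0 < m)%N)
    (A_elem : p.-abelem A) (A_card : #|A| = (p ^ n)%N)
    (B_elem : q.-abelem B) (B_card : #|B| = (q ^ m)%N)
    (G_dprod : (A \x B)%g = G) :
  let alpha := ((p ^ n - 1) %/ (p - 1))%N in
  let beta := ((q ^ m - 1) %/ (q - 1))%N in
  let f := char_poly (Tf p q m) in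
  let g := char_poly (Tg p q n) in
  phiA (power_graph G) =
    char_poly (T1 p q n m)
    * ('X + 1) ^+ (p ^ n * q ^ m - (alpha + 1) * (beta + 1))
    * ('X - (p * q)%:R%:P + p%:R%:P + q%:R%:P) ^+ ((alpha - 1) * (beta - 1))
    * f ^+ (alpha - 1)
    * g ^+ (beta - 1).
Proof.
move=> alpha beta f g.
pose X := abelem_line_space p_prime n_gt0 A_elem A_card.
pose Y := abelem_line_space q_prime m_gt0 B_elem B_card.
have p_gt0 := prime_gt0 p_prime; have q_gt0 := prime_gt0 q_prime.
have cX : (line_num X * line_size X).+1 = (p ^ n)%N.
  by rewrite -(card_point X) card_subg_of.
have cY : (line_num Y * line_size Y).+1 = (q ^ m)%N.
  by rewrite -(card_point Y) card_subg_of.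
have coAB : coprime #|A| #|B|.
  rewrite A_card B_card coprimeXl ?coprimeXr // prime_coprime //.
  by rewrite dvdn_prime2 //; apply/eqP.
(* Comparability is reflexive while the graph has no loops, so ['X] becomes ['X + 1]. *)
have -> : phiA (power_graph G)
    = detF (@comparability_kernel {poly int} X Y ('X + 1)).
  rewrite /phiA (char_poly_detF (fun u v => (power_edge u v)%:R)).
  rewrite (detF_reindex _ (dprod_pair_bij G_dprod)).
  apply: eq_detF => -[a b] [a' b'].
  rewrite power_edgeE !(sgval_dprod_pair G_dprod) /=.
  rewrite !(mem_cycle_dprod G_dprod coAB) ?subgP //.
  rewrite !(mem_cycle_abelem A_elem (subgP _) (subgP _)).
  rewrite !(mem_cycle_abelem B_elem (subgP _) (subgP _)).
  rewrite (inj_eq (bij_inj (dprod_pair_bij G_dprod))) !sgval_eq1.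
  rewrite comparability_kernelE /line_le /= /subg_cycle polyC_natr.
  have [[-> ->]|_] := eqVneq (a, b) (a', b').
    by rewrite !eqxx !orbT /=; ring.
  by rewrite mul0r mulr0.
rewrite detF_comparability_block; last exact: natr_poly_int_neq0.
rewrite detF_block_kernel.
rewrite (det_small_kernel (p := p) (q := q) (n := n) (m := m)) //.
rewrite cX cY.
have PE := natr_pred_expn {poly int} cX.
have QE := natr_pred_expn {poly int} cY.
(* The scalar [p - 1] from a difference of line sums in [A], tensored with the 2 x 2 block of [B],
   gives [f]; exchanging the factors gives [g]. *)
set f1 := (Z in _ * Z ^+ (line_num X - 1) * _).
set g1 := (Z in _ * Z ^+ (line_num Y - 1) * _).
have -> : f1 = f.
  rewrite /f1 /f char_poly_mx22 QE !mxE /= !natrB //.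
  by rewrite ?(polyCM, polyCB, polyCD, polyCN, rmorphXn) /= ?polyC_Posz; ring.
have -> : g1 = g.
  rewrite /g1 /g char_poly_mx22 PE !mxE /= !natrB //.
  by rewrite ?(polyCM, polyCB, polyCD, polyCN, rmorphXn) /= ?polyC_Posz; ring.
have -> : 'X + 1 - (line_size X)%:R * (line_size Y)%:R
    = 'X - (p * q)%:R%:P + p%:R%:P + q%:R%:P :> {poly int}.
  by rewrite /= !natrB // !polyC_natr natrM; ring.
by rewrite /= -/alpha -/beta; ring.
Qed.
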